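(* Let $k\in\mathbb{N}$. For every complex number $s=\sigma+it\neq 1$ with $\sigma>1/2$, $$\zeta^k(s)=\sum_{n\ge -k}(-1)^n\,\ell_{n,k}\left(\frac{s-1}{s}\right)^n,$$ where the series converges absolutely, and $$\ell_{n,k}=\begin{cases}(-1)^n\displaystyle\sum_{j=1}^n\binom{n-1}{j-1}\frac{\lambda_{j+k,k}}{(j+k)!}, & n\ge 1,\\[2mm] (-1)^k\displaystyle\sum_{j=0}^{k+n}\binom{k-j}{-n}(-1)^j\frac{\lambda_{j,k}}{j!}, & -k\le n\le 0.\end{cases}$$
   Context: $\zeta$ denotes the Riemann zeta function. For $k\in\mathbb{N}$, the numbers $\lambda_{j,k}$ ($j\in\mathbb{N}_0$) are the Taylor coefficients of the entire-near-$1$ function $(s-1)^k\zeta^k(s)$ at $s=1$: for $|s-1|\le 1$, $(s-1)^k\zeta^k(s)=\sum_{j\ge0}\frac{\lambda_{j,k}}{j!}(s-1)^j$. Binomial coefficients $\binom{a}{b}=a!/(b!(a-b)!)$ for $0\le b\le a$ integers and $0$ otherwise. *)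

(* Defs.v *)
From mathcomp Require Import all_boot all_order all_algebra.
From mathcomp Require Import all_classical all_reals all_analysis.
From mathcomp Require Import complex.
Set Implicit Arguments. Unset Strict Implicit. Unset Printing Implicit Defensive.
Import Order.TTheory GRing.Theory Num.Theory.
Import numFieldNormedType.Exports.
Local Open Scope ring_scope.
Local Open Scope complex_scope.

(* The complex numbers, seen as a numFieldType (hence a normed field, with
   the complex topology, so that derive1 is the complex derivative). *)
Definition C (R : realType) : numFieldType := R[i].

(* a^z := exp (z * ln a) for a real a > 0 and complex z
   (= e^{Re z ln a} (cos (Im z ln a) + i sin (Im z ln a))). *)
Definition cpow (R : realType) (a : R) (z : C R) : C R :=
  let: x +i* y := (z : R[i]) in
  (expR (x * ln a) * cos (y * ln a)) +i* (expR (x * ln a) * sin (y * ln a)).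

(* Riemann zeta function, via its standard analytic continuation to Re s > 0,
   s <> 1:  zeta s = lim_{N -> oo} ( sum_{n=1}^N n^{-s} - N^{1-s}/(1-s) ).
   (For Re s > 1 this is the Dirichlet series sum_{n>=1} n^{-s}.) *)
Definition zeta (R : realType) (s : C R) : C R :=
  limn (fun N : nat =>
    \sum_(1 <= n < N.+1) cpow (n%:R) (- s) - cpow (N%:R) (1 - s) / (1 - s)).

(* (s-1)^k zeta^k(s), extended by its limit value 1 at s = 1
   (the residue of zeta at 1 is 1). *)
Definition zetak_reg (R : realType) (k : nat) (s : C R) : C R :=
  if s == 1 then 1 else ((s - 1) * zeta s) ^+ k.

(* lambda_{j,k}: j-th derivative at s = 1 of (s-1)^k zeta^k(s), so that
   (s-1)^k zeta^k(s) = sum_j lambda_{j,k}/j! (s-1)^j. *)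
Definition lambda (R : realType) (j k : nat) : C R :=
  derive1n j (@zetak_reg R k) 1.

(* ell_{n,k} for integers n (the formula for n <= 0 is meant for -k <= n <= 0,
   where k + n = k - |n|). *)
Definition ell (R : realType) (n : int) (k : nat) : C R :=
  if (0 < n)%R then
    (-1) ^+ `|n|%N *
      \sum_(1 <= j < `|n|%N.+1)
        'C(`|n|%N.-1, j.-1)%:R * lambda R (j + k) k / (j + k)`!%:R
  else
    (-1) ^+ k *
      \sum_(0 <= j < (k - `|n|%N).+1)
        'C(k - j, `|n|%N)%:R * (-1) ^+ j * lambda R j k / j`!%:R.

(* Main.v *)
Require Import Defs.
From mathcomp Require Import all_boot all_order all_algebra.
From mathcomp Require Import all_classical all_reals all_analysis.
From mathcomp Require Import complex.
From mathcomp Require Import ring lra zify.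
Import Order.TTheory GRing.Theory Num.Theory.
Import numFieldNormedType.Exports.
Import Normc.
Set Implicit Arguments.
Unset Strict Implicit.
Unset Printing Implicit Defensive.
Local Open Scope classical_set_scope.
Local Open Scope ring_scope.
Local Open Scope complex_scope.

(* In the variable z = (s - 1) / s the half-plane Re s > 1/2 is the unit disc,
   and (1 - z)^-1 = s, so it suffices that (1 - z)^k ((s - 1) zeta s)^k is the
   sum of its power series in the whole disc |z| < 1, and to read off its
   coefficients from the Taylor coefficients of ((s - 1) zeta s)^k at 1, using
   the expansions of z^j (1 - z)^(k - j).

   Analyticity on a disc is expressed as uniform approximability by polynomials
   on smaller discs. Cauchy's estimate for polynomials, which needs no integral,
   makes the coefficients and the derivatives of the approximating polynomials
   converge, so that the limit is the sum of its Taylor series on the whole disc.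
   This class is closed under sums, products, composition and uniform limits. It
   contains the exponential, because of (1 + z / n)^n, hence the functions
   (s - 1) sum_(n <= N) n^-s + N^(1 - s), whose consecutive differences are
   O(N^(-1 - delta)) locally uniformly for Re s >= delta > 0. *)

Section ComplexModulus.
Variable R : realType.
Implicit Types (z w : C R) (x : R).

Lemma normcX z n : normc (z ^+ n) = normc z ^+ n.
Proof. by elim: n => [|n IHn]; rewrite ?expr0 ?normc1 // !exprS normcM IHn. Qed.

Lemma normc_ge0 z : 0 <= normc z.
Proof. exact: (@normr_ge0 _ (Rcomplex R)). Qed.

Lemma normc_gt0 z : z != 0 -> 0 < normc z.
Proof. by rewrite -(@normr_gt0 _ (Rcomplex R)). Qed.

Lemma normcB z w : normc (z - w) <= normc z + normc w.
Proof. exact: (@ler_normB _ (Rcomplex R)). Qed.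

Lemma normc_distC z w : normc (z - w) = normc (w - z).
Proof. exact: (@distrC _ (Rcomplex R)). Qed.

Lemma normc_distD w z z' : normc (z - z') <= normc (z - w) + normc (w - z').
Proof. exact: (@ler_distD _ (Rcomplex R)). Qed.

Lemma normc_sum (I : Type) (r : seq I) (P : pred I) (F : I -> C R) :
  normc (\sum_(i <- r | P i) F i) <= \sum_(i <- r | P i) normc (F i).
Proof. exact: (@ler_norm_sum _ (Rcomplex R)). Qed.

Lemma normc_real x : normc (x%:C : C R) = `|x|.
Proof. by rewrite /= expr0n /= addr0 sqrtr_sqr. Qed.

Lemma normc_nat n : normc (n%:R : C R) = n%:R.
Proof. by rewrite -(rmorph_nat (real_complex R)) normc_real normr_nat. Qed.

Lemma sqr_normcE z : normc z ^+ 2 = complex.Re (z : R[i]) ^+ 2 + complex.Im (z : R[i]) ^+ 2.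
Proof. by case: z => x y; rewrite /= sqr_sqrtr // addr_ge0 ?sqr_ge0. Qed.

Lemma Re_le_normc z : `|complex.Re (z : R[i])| <= normc z.
Proof. by rewrite -sqrtr_sqr; case: z => x y; rewrite ler_wsqrtr // lerDl sqr_ge0. Qed.

Lemma Im_le_normc z : `|complex.Im (z : R[i])| <= normc z.
Proof. by rewrite -sqrtr_sqr; case: z => x y; rewrite ler_wsqrtr // lerDr sqr_ge0. Qed.

Lemma normc_imaginary x : normc (0 +i* x : C R) = `|x|.
Proof. by rewrite /= expr0n /= add0r sqrtr_sqr. Qed.

Lemma normc_le_ReIm z : normc z <= `|complex.Re (z : R[i])| + `|complex.Im (z : R[i])|.
Proof.
rewrite -normc_real -[X in _ + X]normc_imaginary.
apply: le_trans (le_normcD _ _); by case: z => x y; simpc.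
Qed.

(* The norm of [C R] takes its values in [C R] itself, hence the library's
   characterizations of limits quantify over complex [e > 0]. *)
Lemma cvg_normcP (u : nat -> C R) (l : C R) :
  u @ \oo --> l <-> forall e : R, 0 < e -> \forall n \near \oo, normc (u n - l) <= e.
Proof.
split=> [/cvgrPdist_le ul e e0|ul].
  have eC : 0 < (e%:C : C R) by rewrite ltcE /= eqxx.
  by apply: filterS (ul _ eC) => n; rewrite normc_distC -lecR.
apply/cvgrPdist_le => -[e y]; rewrite [_ < _]ltcE /= => /andP[/eqP -> e0].
by apply: filterS (ul _ e0) => n; rewrite normc_distC => dist; rewrite [_ <= _]lecR.
Qed.

Lemma cvg_uniform_normcP (T : choiceType) (S : set T) (u : nat -> T -> C R) (f : T -> C R) :
  {uniform S, u @ \oo --> f} <->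
  forall e : R, 0 < e -> \forall n \near \oo, forall t, S t -> normc (u n t - f t) <= e.
Proof.
split=> [uf e e0|uf V /uniform_nbhs[E [+ EV]]].
  have eC : 0 < (e%:C : C R) by rewrite ltcE /= eqxx.
  pose B : set {uniform` S -> C R} := [set g | forall t, S t -> ball (f t) (e%:C : C R) (g t)].
  have /uf[N _ uB] : nbhs (f : {uniform` S -> C R}) B.
    apply/uniform_nbhs; exists [set xy | ball xy.1 (e%:C : C R) xy.2].
    by split=> //; exact: (entourage_ball _ (PosNum eC)).
  exists N => // n Nn t St; have := uB n Nn t St.
  by rewrite /ball /= normc_distC [_ < _]ltcR; exact: ltW.
rewrite -entourage_ballE => -[[e y] /=].
rewrite [_ < _]ltcE /= => /andP[/eqP -> e0] ballE.
have [N _ uN] := uf _ (divr_gt0 e0 (ltr0n R 2)); exists N => // n Nn.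
apply: EV => t St; apply: ballE; rewrite /ball /= [_ < _]ltcR normc_distC.
by apply: le_lt_trans (uN n Nn t St) _; lra.
Qed.

Lemma uniform_cvg_pointwise (T : choiceType) (S : set T) (u : nat -> T -> C R) (f : T -> C R) t :
  {uniform S, u @ \oo --> f} -> S t -> u^~ t @ \oo --> f t.
Proof.
move=> /cvg_uniform_normcP uf St; apply/cvg_normcP => e /uf.
by apply: filterS => n; exact.
Qed.

Lemma normc_lim_le (u : nat -> C R) (l a : C R) (e : R) :
  u @ \oo --> l -> (\forall n \near \oo, normc (u n - a) <= e) -> normc (l - a) <= e.
Proof.
move=> /cvg_normcP ul ua; apply/ler_addgt0Pr => d d0.
have [n [una unl]] := filter_ex (filterI ua (ul d d0)).
by apply: le_trans (normc_distD (u n) l a) _; rewrite addrC lerD // normc_distC.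
Qed.

Lemma cvg_real_complex (x : nat -> R) (l : R) :
  x @ \oo --> l -> (fun n => (x n)%:C : C R) @ \oo --> (l%:C : C R).
Proof.
move=> /cvgrPdist_le xl; apply/cvg_normcP => e /xl.
by apply: filterS => n; rewrite -rmorphB normc_real distrC.
Qed.

Lemma real_cauchy_cvg (x : nat -> R) :
  (forall e : R, 0 < e -> \forall N \near \oo, forall n, (N <= n)%N -> `|x n - x N| <= e) ->
  cvgn x.
Proof.
move=> cauchy_x; apply: cauchy_cvg; apply: cauchy_exP => e e0.
have [N xN] := filter_ex (cauchy_x _ (divr_gt0 e0 (ltr0n R 2))).
exists (x N); exists N => // n /= /xN xnN.
by rewrite /ball /= distrC; apply: le_lt_trans xnN _; lra.
Qed.

Lemma normc_cauchy_cvg (u : nat -> C R) :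
  (forall e : R, 0 < e -> \forall N \near \oo, forall n, (N <= n)%N -> normc (u n - u N) <= e) ->
  cvgn u.
Proof.
move=> cauchy_u.
have cvg_Re : cvgn (fun n => complex.Re (u n : R[i])).
  apply: real_cauchy_cvg => e /cauchy_u; apply: filterS => N uN n /uN.
  by apply: le_trans; apply: le_trans (Re_le_normc _); rewrite raddfB.
have cvg_Im : cvgn (fun n => complex.Im (u n : R[i])).
  apply: real_cauchy_cvg => e /cauchy_u; apply: filterS => N uN n /uN.
  by apply: le_trans; apply: le_trans (Im_le_normc _); rewrite raddfB.
have -> : u = fun n => (complex.Re (u n : R[i]))%:C + 'i%C * (complex.Im (u n : R[i]))%:C.
  by apply/funext => n; exact: complexE.
apply: cvgP; apply: cvgD (cvg_real_complex cvg_Re) _.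
exact: cvgM (cvg_cst _) (cvg_real_complex cvg_Im).
Qed.

Definition uniform_cauchy (T : Type) (S : set T) (u : nat -> T -> C R) :=
  forall e : R, 0 < e ->
    \forall N \near \oo, forall n t, (N <= n)%N -> S t -> normc (u n t - u N t) <= e.

Lemma uniform_cvg_cauchy (T : choiceType) (S : set T) (u : nat -> T -> C R) (f : T -> C R) :
  {uniform S, u @ \oo --> f} -> uniform_cauchy S u.
Proof.
move=> /cvg_uniform_normcP uf e e0.
have [N0 _ uN0] := uf _ (divr_gt0 e0 (ltr0n R 2)); exists N0 => // N /= N0N n t Nn St.
have := uN0 n (leq_trans N0N Nn) t St; have := uN0 N N0N t St.
by have := normc_distD (f t) (u n t) (u N t); rewrite (normc_distC (f t)); lra.
Qed.

Lemma uniform_cauchy_cvg (T : choiceType) (S : set T) (u : nat -> T -> C R) :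
  uniform_cauchy S u ->
  (forall t, S t -> cvgn (u^~ t)) /\ {uniform S, u @ \oo --> (fun t => limn (u^~ t))}.
Proof.
move=> cauchy_u; have cvg_u t : S t -> cvgn (u^~ t).
  by move=> St; apply: normc_cauchy_cvg => e /cauchy_u; apply: filterS => N uN n /uN; apply.
split=> //; apply/cvg_uniform_normcP => e /cauchy_u; apply: filterS => N uN t St.
rewrite normc_distC; apply: normc_lim_le (cvg_u t St) _.
by exists N => // n Nn; exact: uN.
Qed.

End ComplexModulus.

Section PolynomialCauchyEstimates.
Variable R : realType.
Implicit Types (p : {poly C R}) (a w z : C R) (r B : R).

Lemma normc_sqr_root z r : 0 <= r -> normc z = r ^+ 2 -> exists2 w, normc w = r & z = w ^+ 2.
Proof.
move=> r0 zr; exists (sqrtc z); last by rewrite sqr_sqrtc.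
by apply/eqP; rewrite -(eqrXn2 (n := 2)) ?normc_ge0 // -normcX sqr_sqrtc zr.
Qed.

Lemma normc_even_odd_poly p w B : normc p.[w] <= B -> normc p.[- w] <= B ->
  normc (even_poly p).[w ^+ 2] <= B /\ normc (odd_poly p).[w ^+ 2] * normc w <= B.
Proof.
set E := (even_poly p).[_]; set O := (odd_poly p).[_].
have pE x : p.[x] = (even_poly p).[x ^+ 2] + (odd_poly p).[x ^+ 2] * x.
  by rewrite -{1}(poly_even_odd p) hornerD hornerMX !horner_comp hornerXn.
rewrite !pE sqrrN -/E -/O mulrN => pw pNw; rewrite -normcM; split.
- have := le_normcD (E + O * w) (E - O * w).
  by rewrite addrACA subrr addr0 -mulr2n normcMn mulr2n; lra.
- have := normcB (E + O * w) (E - O * w).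
  by rewrite opprB addrC subrKA -mulr2n normcMn mulr2n; lra.
Qed.

(* The even and odd parts [E] and [O] of [p z = E (z ^+ 2) + z * O (z ^+ 2)] are
   bounded on the circle of radius [r ^+ 2] by [B] and [B / r]. *)
Lemma coef_cauchy_estimate p n r B : 0 < r ->
  (forall z, normc z = r -> normc p.[z] <= B) -> normc p`_n * r ^+ n <= B.
Proof.
have [m] := ubnP (size p); elim: m => // m IHm in p n r B *.
rewrite ltnS => pm r0 pB; have r0' := ltW r0.
have [p1|p1] := leqP (size p) 1.
  have := pB r%:C; rewrite normc_real ger0_norm // => /(_ erefl).
  rewrite (size1_polyC p1) hornerC coefC; case: n => [|n]; first by rewrite expr0 mulr1.
  by apply: le_trans; rewrite normc0 mul0r normc_ge0.
have halves z : normc z = r ^+ 2 ->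
    normc (even_poly p).[z] <= B /\ normc (odd_poly p).[z] * r <= B.
  move=> /(normc_sqr_root r0')[w wr ->]; rewrite -[X in _ * X]wr.
  by apply: normc_even_odd_poly; apply: pB; rewrite ?normcN.
rewrite -(odd_double_half n); case: (odd n); rewrite ?add1n ?add0n.
- rewrite -coef_odd_poly exprSr -muln2 mulnC exprM mulrA -ler_pdivlMr //.
  apply: IHm => [||z /halves[_]]; rewrite ?exprn_gt0 // ?ler_pdivlMr //.
  by have := size_odd_poly p; lia.
- rewrite -coef_even_poly -muln2 mulnC exprM.
  apply: IHm => [||z /halves[]]; rewrite ?exprn_gt0 //.
  by have := size_even_poly p; rewrite uphalfE; lia.
Qed.

Lemma nderivn_cauchy_estimate p a n r B : 0 < r ->
  (forall z, normc (z - a) = r -> normc p.[z] <= B) -> normc p^`N(n).[a] * r ^+ n <= B.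
Proof.
move=> r0 pB; pose q := \poly_(i < size p) p^`N(i).[a].
have qE h : q.[h] = p.[a + h] by rewrite horner_poly nderiv_taylor //; exact: mulrC.
have -> : p^`N(n).[a] = q`_n.
  by rewrite coef_poly; case: ltnP => // ?; rewrite nderivn_poly0 ?horner0.
by apply: coef_cauchy_estimate => // z zr; rewrite qE; apply: pB; rewrite addrC addKr.
Qed.

Lemma geometric_sum_le (x : R) n : 0 <= x -> x < 1 -> \sum_(i < n) x ^+ i <= (1 - x)^-1.
Proof.
move=> x0 x1; have y0 : 0 < 1 - x by rewrite subr_gt0.
rewrite -(ler_pM2l y0) mulfV ?lt0r_neq0 // -opprB mulNr -subrX1 opprB gerBl.
exact: exprn_ge0.
Qed.

Lemma normc_power_term_le (c : nat -> C R) r B z i : 0 < r ->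
  normc (c i) * r ^+ i <= B -> normc (c i * z ^+ i) <= B * (normc z / r) ^+ i.
Proof.
move=> r0 cB; rewrite normcM normcX exprMn exprVn mulrA ler_pdivlMr ?exprn_gt0 // mulrAC.
by rewrite ler_wpM2r // exprn_ge0 ?normc_ge0.
Qed.

Lemma normc_power_sum_le (c : nat -> C R) r t B n z :
  0 < r -> t < r -> normc z <= t -> (forall i, normc (c i) * r ^+ i <= B) ->
  normc (\sum_(i < n) c i * z ^+ i) <= B / (1 - t / r).
Proof.
move=> r0 tr zt cB; have t0 : 0 <= t := le_trans (normc_ge0 z) zt.
have x0 : 0 <= t / r by rewrite divr_ge0 // ltW.
have x1 : t / r < 1 by rewrite ltr_pdivrMr // mul1r.
have B0 : 0 <= B by have := cB 0%N; rewrite expr0 mulr1; apply: le_trans (normc_ge0 _).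
apply: le_trans (ler_wpM2l B0 (geometric_sum_le n x0 x1)).
rewrite mulr_sumr; apply: le_trans (normc_sum _ _ _) _; apply: ler_sum => i _.
apply: le_trans (normc_power_term_le z r0 (cB i)) _; rewrite ler_wpM2l //.
by rewrite lerXn2r ?nnegrE ?divr_ge0 ?normc_ge0 ?ler_pM2r ?invr_gt0 // ltW.
Qed.

Lemma poly_taylor1_remainder_le p a h r B : 0 < r ->
  (forall z, normc (z - a) = r -> normc p.[z] <= B) -> normc h <= r / 2 ->
  normc (p.[a + h] - p.[a] - h * p^`().[a]) <= 2 * B / r ^+ 2 * normc h ^+ 2.
Proof.
move=> r0 pB hr; have wide : (size p <= (size p).+2)%N by rewrite -addn2 leq_addr.
have -> : p.[a + h] - p.[a] - h * p^`().[a] = \sum_(i < size p) p^`N(i.+2).[a] * h ^+ i.+2.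
  rewrite (nderiv_taylor_wide _ wide); last exact: mulrC.
  by rewrite !big_ord_recl /= nderivn0 nderivn1 expr0 /bump /= expr1; ring.
under eq_bigr do rewrite -addn2 exprD mulrA; rewrite -mulr_suml.
rewrite normcM normcX; apply: ler_wpM2r; first by rewrite exprn_ge0 ?normc_ge0.
have -> : 2 * B / r ^+ 2 = B / r ^+ 2 / (1 - r / 2 / r) by field; rewrite lt0r_neq0.
apply: (normc_power_sum_le (c := fun i => p^`N(i + 2).[a])) => // [|i]; first by lra.
rewrite ler_pdivlMr ?exprn_gt0 // -mulrA -exprD.
exact: nderivn_cauchy_estimate.
Qed.

End PolynomialCauchyEstimates.

Section PolynomialApproximation.
Variable R : realType.
Implicit Types (p q : {poly C R}) (f g : C R -> C R) (S : set (C R)) (r : R).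

Definition disc r : set (C R) := [set z | normc z <= r].

Definition poly_approx S f :=
  forall e : R, 0 < e -> exists p, forall z, S z -> normc (p.[z] - f z) <= e.

Lemma poly_approx_horner S p : poly_approx S (horner p).
Proof. by move=> e e0; exists p => z _; rewrite subrr normc0 ltW. Qed.

Lemma eq_poly_approx S f g : {in S, f =1 g} -> poly_approx S f -> poly_approx S g.
Proof.
by move=> fg Hf e /Hf[p pf]; exists p => z Sz; rewrite -fg ?inE //; exact: pf.
Qed.

Lemma poly_approx_cst S (c : C R) : poly_approx S (fun=> c).
Proof. by apply: eq_poly_approx (poly_approx_horner S c%:P) => z _; rewrite hornerC. Qed.

Lemma poly_approx_id S : poly_approx S id.
Proof. by apply: eq_poly_approx (poly_approx_horner S 'X) => z _; rewrite hornerX. Qed.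

Lemma poly_approx_lim S (F : nat -> C R -> C R) f :
  (forall n, poly_approx S (F n)) -> {uniform S, F @ \oo --> f} -> poly_approx S f.
Proof.
move=> HF /cvg_uniform_normcP Ff e e0; have e2 : 0 < e / 2 by lra.
have [n Fnf] := filter_ex (Ff _ e2); have [p pF] := HF n _ e2.
exists p => z Sz; have := normc_distD (F n z) p.[z] (f z).
by have := pF z Sz; have := Fnf z Sz; lra.
Qed.

Lemma poly_approxD S f g :
  poly_approx S f -> poly_approx S g -> poly_approx S (fun z => f z + g z).
Proof.
move=> Hf Hg e e0; have e2 : 0 < e / 2 by lra.
have [p pf] := Hf _ e2; have [q qg] := Hg _ e2.
exists (p + q) => z Sz; rewrite hornerD opprD addrACA.
by apply: le_trans (le_normcD _ _) _; have := pf z Sz; have := qg z Sz; lra.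
Qed.

Lemma poly_bounded_on_disc p r :
  exists2 B : R, 0 < B & forall z, disc r z -> normc p.[z] <= B.
Proof.
exists (1 + \sum_(i < size p) normc p`_i * `|r| ^+ i).
  by rewrite ltr_pwDl // sumr_ge0 // => i _; rewrite mulr_ge0 ?normc_ge0 ?exprn_ge0.
move=> z zr; rewrite horner_coef; apply: le_trans (normc_sum _ _ _) _.
rewrite ler_wpDl //; apply: ler_sum => i _; rewrite normcM normcX.
rewrite ler_wpM2l ?normc_ge0 // lerXn2r ?nnegrE ?normc_ge0 //.
exact: le_trans zr (ler_norm _).
Qed.

Lemma poly_approx_bounded f r : poly_approx (disc r) f ->
  exists2 B : R, 0 < B & forall z, disc r z -> normc (f z) <= B.
Proof.
move=> /(_ 1 ltr01)[p pf]; have [B B0 pB] := poly_bounded_on_disc p r.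
exists (B + 1) => [|z zr]; first by lra.
rewrite -[f z](subKr p.[z]); apply: le_trans (normcB _ _) _.
by apply: lerD; [exact: pB | exact: pf].
Qed.

Lemma poly_approxM f g r : poly_approx (disc r) f -> poly_approx (disc r) g ->
  poly_approx (disc r) (fun z => f z * g z).
Proof.
move=> Hf Hg e e0; have [B B0 gB] := poly_approx_bounded Hg.
have [p pf] := Hf (e / (2 * B)) ltac:(by rewrite divr_gt0 // mulr_gt0).
have [A A0 pA] := poly_bounded_on_disc p r.
have [q qg] := Hg (e / (2 * A)) ltac:(by rewrite divr_gt0 // mulr_gt0).
exists (p * q) => z Sz; rewrite hornerM.
have -> : p.[z] * q.[z] - f z * g z = p.[z] * (q.[z] - g z) + (p.[z] - f z) * g z by ring.
apply: le_trans (le_normcD _ _) _; rewrite !normcM.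
have -> : e = A * (e / (2 * A)) + e / (2 * B) * B by field; rewrite !lt0r_neq0.
by apply: lerD; apply: ler_pM; rewrite ?normc_ge0 //; [exact: pA|exact: qg|exact: pf|exact: gB].
Qed.

Lemma poly_approxX f r n : poly_approx (disc r) f ->
  poly_approx (disc r) (fun z => f z ^+ n).
Proof.
move=> Hf; elim: n => [|n IHn].
  by apply: eq_poly_approx (poly_approx_cst _ 1) => z _; rewrite expr0.
by apply: eq_poly_approx (poly_approxM Hf IHn) => z _; rewrite exprS.
Qed.

Lemma poly_approx_sum S (I : Type) (s : seq I) (F : I -> C R -> C R) :
  (forall i, poly_approx S (F i)) -> poly_approx S (fun z => \sum_(i <- s) F i z).
Proof.
move=> HF; elim: s => [|i s IHs].
  by apply: eq_poly_approx (poly_approx_cst _ 0) => z _; rewrite big_nil.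
by apply: eq_poly_approx (poly_approxD (HF i) IHs) => z _; rewrite big_cons.
Qed.

Lemma poly_approx_comp S f g r : poly_approx S f -> poly_approx (disc r) g ->
  (forall z, disc r z -> S (g z)) -> poly_approx (disc r) (f \o g).
Proof.
move=> Hf Hg gS e e0; have e2 : 0 < e / 2 by lra.
have [p pf] := Hf _ e2.
have Hpg : poly_approx (disc r) (fun z => p.[g z]).
  have monomial i : poly_approx (disc r) (fun z => p`_i * g z ^+ i).
    by apply: poly_approxM; [exact: poly_approx_cst | exact: poly_approxX].
  have := poly_approx_sum (index_enum 'I_(size p)) (fun i : 'I__ => monomial i).
  by apply: eq_poly_approx => z _; rewrite horner_coef.
have [q qpg] := Hpg _ e2; exists q => z zr.
have := normc_distD p.[g z] q.[z] (f (g z)).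
by have := pf _ (gS z zr); have := qpg z zr => /=; lra.
Qed.

Lemma subr1_neq0 (z : C R) : normc z < 1 -> 1 - z != 0.
Proof. by apply: contraTneq => /subr0_eq <-; rewrite normc1 ltxx. Qed.

Lemma poly_approx_inv1B r : 0 <= r -> r < 1 -> poly_approx (disc r) (fun z => (1 - z)^-1).
Proof.
move=> r0 r1 e e0; have y0 : 0 < 1 - r by lra.
have /cvgrPdist_le/(_ _ (mulr_gt0 e0 y0))[N _ /(_ N (leqnn N))] :
  (fun n => r ^+ n) @ \oo --> 0 by apply: cvg_expr; rewrite ger0_norm.
rewrite sub0r normrN ger0_norm ?exprn_ge0 // => rN.
exists (\poly_(i < N) 1) => z zr; have z1 : normc z < 1 := le_lt_trans zr r1.
have nz := subr1_neq0 z1.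
have -> : (\poly_(i < N) 1).[z] - (1 - z)^-1 = - z ^+ N / (1 - z).
  rewrite horner_poly; under eq_bigr do rewrite mul1r.
  apply: (mulIf nz); rewrite mulrBl divfK // mulVf //.
  have -> : (\sum_(i < N) z ^+ i) * (1 - z) = - ((z - 1) * (\sum_(i < N) z ^+ i)) by ring.
  by rewrite -subrX1; ring.
rewrite normcM normcN normcX normcV ler_pdivrMr ?normc_gt0 //.
apply: le_trans (_ : r ^+ N <= _); first by rewrite lerXn2r ?nnegrE ?normc_ge0.
apply: le_trans rN _; rewrite ler_pM2l //.
by have := normc_distD z 1 0; rewrite !subr0 normc1; move: zr; rewrite /disc /=; lra.
Qed.

End PolynomialApproximation.

Section PowerSeries.
Variable R : realType.
Implicit Types (f g : C R -> C R) (a b : nat -> C R) (rho r e : R) (z c : C R).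

Definition analytic_on rho f := forall r, 0 < r -> r < rho -> poly_approx (disc r) f.

Definition partial_sum a n z : C R := \sum_(i < n) a i * z ^+ i.

Definition powser rho f a :=
  forall r, 0 < r -> r < rho -> {uniform disc r, partial_sum a @ \oo --> f}.

Lemma partial_sum_poly a n : partial_sum a n = horner (\poly_(i < n) a i).
Proof. by apply/funext => z; rewrite horner_poly. Qed.

Lemma partial_sumB a b n z :
  partial_sum (fun i => a i - b i) n z = partial_sum a n z - partial_sum b n z.
Proof. by rewrite -sumrB; apply: eq_bigr => i _; rewrite mulrBl. Qed.

Lemma powser_analytic rho f a : powser rho f a -> analytic_on rho f.
Proof.
move=> fa r r0 rr; apply: poly_approx_lim (fa r r0 rr) => n.
by rewrite partial_sum_poly; exact: poly_approx_horner.
Qed.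

Lemma sub_powser rho rho' f a : rho' <= rho -> powser rho f a -> powser rho' f a.
Proof. by move=> le_rho fa r r0 rr; apply: fa => //; exact: lt_le_trans le_rho. Qed.

Lemma eq_powser rho f g a b : (forall z, normc z < rho -> f z = g z) -> a =1 b ->
  powser rho f a -> powser rho g b.
Proof.
move=> fg /funext <- fa r r0 rr; apply/cvg_uniform_normcP => e e0.
have /cvg_uniform_normcP/(_ e e0) := fa r r0 rr; apply: filterS => n + z zr.
by move/(_ z zr); rewrite fg //; exact: le_lt_trans rr.
Qed.

Lemma powser_horner rho (p : {poly C R}) : powser rho (horner p) (fun n => p`_n).
Proof.
move=> r r0 rr; apply/cvg_uniform_normcP => e e0; exists (size p) => // n /= pn z _.
by rewrite (horner_coef_wide _ pn) subrr normc0 ltW.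
Qed.

Lemma powserD rho f g a b : powser rho f a -> powser rho g b ->
  powser rho (fun z => f z + g z) (fun n => a n + b n).
Proof.
move=> fa gb r r0 rr; apply/cvg_uniform_normcP => e e0; have e2 : 0 < e / 2 by lra.
move/cvg_uniform_normcP: (fa r r0 rr) => /(_ _ e2).
move/cvg_uniform_normcP: (gb r r0 rr) => /(_ _ e2).
apply: filterS2 => n gbn fan z zr.
have -> : partial_sum (fun i => a i + b i) n z = partial_sum a n z + partial_sum b n z.
  by rewrite -big_split; apply: eq_bigr => i _; rewrite mulrDl.
rewrite opprD addrACA; apply: le_trans (le_normcD _ _) _.
by have := fan z zr; have := gbn z zr; lra.
Qed.

Lemma powserZ rho f a c : powser rho f a -> powser rho (fun z => c * f z) (fun n => c * a n).
Proof.
move=> fa r r0 rr; apply/cvg_uniform_normcP => e e0.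
have K0 : 0 < normc c + 1 by rewrite ltr_wpDl ?normc_ge0.
move/cvg_uniform_normcP: (fa r r0 rr) => /(_ _ (divr_gt0 e0 K0)).
apply: filterS => n fan z zr.
have -> : partial_sum (fun i => c * a i) n z = c * partial_sum a n z.
  by rewrite mulr_sumr; apply: eq_bigr => i _; rewrite mulrA.
rewrite -mulrBr normcM; apply: le_trans (ler_wpM2l (normc_ge0 c) (fan z zr)) _.
by rewrite mulrA ler_pdivrMr // mulrC ler_pM2l // lerDl.
Qed.

Lemma powser_sum rho (F : nat -> C R -> C R) (A : nat -> nat -> C R) n :
  (forall i, powser rho (F i) (A i)) ->
  powser rho (fun z => \sum_(i < n) F i z) (fun m => \sum_(i < n) A i m).
Proof.
move=> FA; elim: n => [|n IHn].
  by apply: eq_powser (@powser_horner rho 0) => [z _|m]; rewrite ?horner0 ?coef0 big_ord0.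
by apply: eq_powser (powserD IHn (FA n)) => [z _|m]; rewrite big_ord_recr.
Qed.

Lemma powserMX rho f a : powser rho f a ->
  powser rho (fun z => z * f z) (fun n => if n is m.+1 then a m else 0).
Proof.
move=> fa r r0 rr; apply/cvg_uniform_normcP => e e0.
move/cvg_uniform_normcP: (fa r r0 rr) => /(_ _ (divr_gt0 e0 r0))[N _ fan].
exists N.+1 => // -[//|n] Nn z zr; rewrite /partial_sum big_ord_recl mul0r add0r.
under eq_bigr do rewrite /= /bump /= exprS mulrCA.
rewrite -mulr_sumr -mulrBr normcM -[e](divfK (lt0r_neq0 r0)) mulrC.
by apply: ler_pM; rewrite ?normc_ge0 //; exact: fan.
Qed.

Lemma powser_coef_cauchy_estimate rho f g a b r e n : powser rho f a -> powser rho g b ->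
  0 < r -> r < rho -> (forall z, disc r z -> normc (f z - g z) <= e) ->
  normc (a n - b n) * r ^+ n <= e.
Proof.
move=> fa gb r0 rr fg; apply/ler_addgt0Pr => d d0; have d2 : 0 < d / 2 by rewrite divr_gt0.
move/cvg_uniform_normcP: (fa r r0 rr) => /(_ _ d2) fan.
move/cvg_uniform_normcP: (gb r r0 rr) => /(_ _ d2) gbn.
have [N [[fN gN] nN]] := filter_ex (filterI (filterI fan gbn) (nbhs_infty_gt n)).
have -> : a n - b n = (\poly_(i < N) (a i - b i))`_n by rewrite coef_poly nN.
apply: coef_cauchy_estimate => // z zr; have {}zr : disc r z by rewrite /disc /= zr.
rewrite -partial_sum_poly partial_sumB.
have -> : partial_sum a N z - partial_sum b N z =
  (f z - g z) + ((partial_sum a N z - f z) - (partial_sum b N z - g z)) by ring.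
apply: le_trans (le_normcD _ _) _; apply: lerD; first exact: fg.
apply: le_trans (normcB _ _) _; rewrite [leRHS](splitr d).
by apply: lerD; [exact: fN | exact: gN].
Qed.

Lemma powser_uniq rho f g a b : 0 < rho -> powser rho f a -> powser rho g b ->
  (forall z, normc z < rho -> f z = g z) -> a =1 b.
Proof.
move=> rho0 fa gb fg n; apply/eqP; rewrite -subr_eq0; apply/eqP/eq0_normc/eqP.
have r0 : 0 < rho / 2 by lra.
rewrite eq_le normc_ge0 andbT -(ler_pM2r (exprn_gt0 n r0)) mul0r.
apply: (powser_coef_cauchy_estimate n fa gb) => // [|z zr]; first by lra.
by rewrite fg ?subrr ?normc0 //; apply: le_lt_trans zr _; lra.
Qed.

Lemma powser_coef_bound rho f a r : powser rho f a -> 0 < r -> r < rho ->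
  exists2 B : R, 0 < B & forall n, normc (a n) * r ^+ n <= B.
Proof.
move=> fa r0 rr; have [B B0 fB] := poly_approx_bounded (powser_analytic fa r0 rr).
exists B => // n; rewrite -[a n]subr0 -(coef0 _ n).
apply: (powser_coef_cauchy_estimate n fa (@powser_horner rho 0)) => // z zr.
by rewrite horner0 subr0; exact: fB.
Qed.

Lemma powser_cvg rho f a z : powser rho f a -> normc z < rho ->
  series (fun n => a n * z ^+ n) @ \oo --> f z.
Proof.
move=> fa zr; have rho0 := le_lt_trans (normc_ge0 z) zr.
have z0 := normc_ge0 z; pose r := (normc z + rho) / 2.
have r0 : 0 < r by rewrite /r; lra.
have rr : r < rho by rewrite /r; lra.
rewrite (_ : series _ = (partial_sum a)^~ z); last by apply/funext => n; rewrite seriesEord.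
by apply: uniform_cvg_pointwise (fa r r0 rr) _; rewrite /disc /= /r; lra.
Qed.

Lemma powser_normr_cvg rho f a z : powser rho f a -> normc z < rho ->
  cvgn (series (fun n => `|a n * z ^+ n|)).
Proof.
move=> fa zr; have z0 := normc_ge0 z; pose r := (normc z + rho) / 2.
have r0 : 0 < r by rewrite /r; lra.
have rr : r < rho by rewrite /r; lra.
have [B B0 aB] := powser_coef_bound fa r0 rr.
have x0 : 0 <= normc z / r by rewrite divr_ge0 // ltW.
have real_cvg : cvgn (series (fun n => normc (a n * z ^+ n))).
  apply: (@series_le_cvg _ _ (geometric B (normc z / r))) => [n|n|n|].
  - exact: normc_ge0.
  - by rewrite mulr_ge0 ?exprn_ge0 // ltW.
  - exact: normc_power_term_le.
  - apply: is_cvg_geometric_series; rewrite ger0_norm // ltr_pdivrMr // mul1r.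
    by rewrite /r; lra.
have -> : series (fun n => `|a n * z ^+ n|) =
    fun n => (series (fun n => normc (a n * z ^+ n)) n)%:C :> C R.
  by apply/funext => n; rewrite /series /= rmorph_sum.
exact: cvgP (cvg_real_complex real_cvg).
Qed.

End PowerSeries.

Section LimitsOfPowerSeries.
Variable R : realType.
Implicit Types (f : C R -> C R) (rho r e : R).

Section Weierstrass.
Variables (rho : R) (F : nat -> C R -> C R) (A : nat -> nat -> C R) (f : C R -> C R).
Hypothesis rho_gt0 : 0 < rho.
Hypothesis FA : forall n, powser rho (F n) (A n).
Hypothesis Ff : forall r, 0 < r -> r < rho -> {uniform disc r, F @ \oo --> f}.

Let a i := limn (A^~ i).

Lemma powser_coef_cauchy r e : 0 < r -> r < rho -> 0 < e ->
  \forall N \near \oo, forall n i, (N <= n)%N -> normc (A n i - A N i) * r ^+ i <= e.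
Proof.
move=> r0 rr e0; apply: filterS (uniform_cvg_cauchy (Ff r0 rr) e0) => N FN n i Nn.
by apply: (powser_coef_cauchy_estimate i (@FA n) (@FA N)) => // z; exact: FN.
Qed.

Lemma powser_coef_cvg i : A^~ i @ \oo --> a i.
Proof.
have rho0 := rho_gt0; have r0 : 0 < rho / 2 by lra.
apply: normc_cauchy_cvg => e e0; have ri : 0 < (rho / 2) ^+ i by rewrite exprn_gt0.
apply: filterS (powser_coef_cauchy r0 _ (mulr_gt0 e0 ri)) => [N AN n|]; last by lra.
by move/(AN n i); rewrite ler_pM2r.
Qed.

Lemma powser_coef_lim_dist_le r e : 0 < r -> r < rho -> 0 < e ->
  \forall N \near \oo, forall i, normc (a i - A N i) * r ^+ i <= e.
Proof.
move=> r0 rr e0; apply: filterS (powser_coef_cauchy r0 rr e0) => N AN i.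
rewrite -ler_pdivlMr ?exprn_gt0 //; apply: normc_lim_le (@powser_coef_cvg i) _.
by exists N => // n Nn; rewrite ler_pdivlMr ?exprn_gt0 //; exact: AN.
Qed.

Lemma powser_lim : powser rho f a.
Proof.
move=> t t0 tr; apply/cvg_uniform_normcP => e e0; pose r := (t + rho) / 2.
have r0 : 0 < r by rewrite /r; lra.
have rr : r < rho by rewrite /r; lra.
have tr' : t < r by rewrite /r; lra.
have y0 : 0 < 1 - t / r by rewrite subr_gt0 ltr_pdivrMr // mul1r.
have e3 : 0 < e / 3 by lra.
move/cvg_uniform_normcP: (Ff t0 tr) => /(_ _ e3) Fnear.
have [N [AN FN]] := filter_ex (filterI (powser_coef_lim_dist_le r0 rr (mulr_gt0 e3 y0)) Fnear).
move/cvg_uniform_normcP: (@FA N _ t0 tr) => /(_ _ e3); apply: filterS => n FAn z zt.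
have dist_coef : normc (partial_sum a n z - partial_sum (A N) n z) <= e / 3.
  rewrite -partial_sumB -[leRHS](mulfK (lt0r_neq0 y0)).
  exact: normc_power_sum_le.
have := normc_distD (partial_sum (A N) n z) (partial_sum a n z) (f z).
have := normc_distD (F N z) (partial_sum (A N) n z) (f z).
by have := FAn z zt; have := FN z zt; lra.
Qed.

End Weierstrass.

Lemma analytic_on_poly_seq rho f : 0 < rho -> analytic_on rho f ->
  exists p : nat -> {poly C R}, forall r, 0 < r -> r < rho ->
    {uniform disc r, (fun n => horner (p n)) @ \oo --> f}.
Proof.
move=> rho0 Hf; pose s n : R := rho - rho / n.+2%:R.
have /choice[p pf] n :
    exists p : {poly C R}, forall z, disc (s n) z -> normc (p.[z] - f z) <= n.+1%:R^-1.
  have sn : rho / n.+2%:R < rho by rewrite ltr_pdivrMr // ltr_pMr // (ltr_nat _ 1).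
  by apply: Hf; rewrite ?subr_gt0 // /s gtrBl divr_gt0.
exists p => r r0 rr; apply/cvg_uniform_normcP => e e0.
have d0 : 0 < (rho - r) / rho by rewrite divr_gt0 ?subr_gt0.
apply: filterS2 (near_infty_natSinv_lt (PosNum e0)) (near_infty_natSinv_lt (PosNum d0)).
move=> n /= ne nd z zr; apply: le_trans (ltW ne); apply: pf; apply: le_trans zr _.
rewrite /s lerBrDr -lerBrDl -ler_pdivlMl // mulrC; apply: le_trans (ltW nd).
by rewrite lef_pV2 ?posrE // ler_nat.
Qed.

Lemma analytic_powser rho f : analytic_on rho f -> exists a, powser rho f a.
Proof.
move=> Hf; have [rho0|rho0] := ltP 0 rho; last first.
  by exists (fun=> 0) => r r0 rr; have := lt_le_trans rr rho0; rewrite ltNge ltW.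
have [p pf] := analytic_on_poly_seq rho0 Hf.
by exists (fun i => limn (fun n => (p n)`_i)); apply: powser_lim pf => // n; exact: powser_horner.
Qed.

End LimitsOfPowerSeries.

Section Differentiation.
Variable R : realType.
Implicit Types (f : C R -> C R) (a : nat -> C R) (rho r : R) (z w c : C R).

Lemma derive1_quadratic_remainder f z (l : C R) (K d : R) : 0 < d ->
  (forall h, normc h <= d -> normc (f (z + h) - f z - h * l) <= K * normc h ^+ 2) ->
  derive1 f z = l.
Proof.
move=> d0 fK; rewrite /derive1; apply: cvg_lim; first exact: norm_hausdorff.
apply/cvgrPdist_le => -[e y]; rewrite [_ < _]ltcE /= => /andP[/eqP -> e0].
have K0 : 0 < `|K| + 1 by rewrite ltr_wpDl.
pose d' := Num.min d (e / (`|K| + 1)).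
have dC : 0 < (d'%:C : C R) by rewrite [_ < _]ltcR lt_min d0 divr_gt0.
exists (d'%:C) => //= h; rewrite /ball /= sub0r normrN [_ < _]ltcR lt_min => /andP[hd he] h0.
rewrite distrC; have -> : h^-1 *: (f (h + z) - f z) - l = h^-1 * (f (z + h) - f z - h * l).
  by rewrite mulrBr mulKf // [h + z]addrC.
have hC := normc_gt0 h0.
rewrite [_ <= _]lecR normcM normcV mulrC ler_pdivrMr //.
apply: le_trans (fK h (ltW hd)) _; rewrite expr2 mulrA ler_pM2r //.
move: he; rewrite ltr_pdivlMr // => he; apply: le_trans (ltW he).
by rewrite mulrC ler_pM2l // (le_trans (ler_norm K)) // lerDl.
Qed.

Lemma derive1_shift f c z : derive1 (fun w => f (c + w)) z = derive1 f (c + z).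
Proof. by rewrite /derive1; under eq_fun do rewrite addrCA. Qed.

Lemma derive1n_shift f c n z : derive1n n (fun w => f (c + w)) z = derive1n n f (c + z).
Proof.
elim: n z => [//|n IHn] z; rewrite !derive1nS.
by rewrite (_ : derive1n n _ = fun w => derive1n n f (c + w)) ?derive1_shift //; exact/funext.
Qed.

Lemma sphere_in_disc r r' z w : normc z <= r -> normc (w - z) = r' - r -> disc r' w.
Proof.
move=> zr wz; rewrite /disc /= -[w](subrK z).
by apply: le_trans (le_normcD _ _) _; rewrite wz; lra.
Qed.

Lemma deriv_uniform_cauchy (p : nat -> {poly C R}) r r' : r < r' ->
  uniform_cauchy (disc r') (fun n => horner (p n)) ->
  uniform_cauchy (disc r) (fun n => horner (p n)^`()).
Proof.
move=> rr' cauchy_p e e0; have d0 : 0 < r' - r by rewrite subr_gt0.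
apply: filterS (cauchy_p _ (mulr_gt0 e0 d0)) => N pN n z Nn zr.
rewrite -hornerN -hornerD -derivB -nderivn1 -(ler_pM2r d0) -{2}[r' - r]expr1.
apply: nderivn_cauchy_estimate => // w /(sphere_in_disc zr) wr'.
by rewrite hornerD hornerN; exact: pN.
Qed.

Lemma uniform_poly_bounded (p : nat -> {poly C R}) f r :
  {uniform disc r, (fun n => horner (p n)) @ \oo --> f} ->
  exists B : R, \forall n \near \oo, forall z, disc r z -> normc (p n).[z] <= B.
Proof.
move=> /uniform_cvg_cauchy/(_ 1 ltr01)/filter_ex[N pN].
have [B _ pB] := poly_bounded_on_disc (p N) r.
exists (1 + B); exists N => // n Nn z zr; rewrite -[(p n).[z]](subrK (p N).[z]).
by apply: le_trans (le_normcD _ _) _; apply: lerD; [exact: pN | exact: pB].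
Qed.

Lemma deriv_uniform_cvg (p : nat -> {poly C R}) f r r' : r < r' ->
  {uniform disc r', (fun n => horner (p n)) @ \oo --> f} ->
  {uniform disc r, (fun n => horner (p n)^`()) @ \oo --> derive1 f}.
Proof.
move=> rr' pf; have cauchy_dp := deriv_uniform_cauchy rr' (uniform_cvg_cauchy pf).
have [dp_cvg] := uniform_cauchy_cvg cauchy_dp.
set g := fun z => limn _ => dp_unif.
have derive1_f z : disc r z -> derive1 f z = g z.
  move=> zr; have [B pB] := uniform_poly_bounded pf; have d0 : 0 < r' - r by rewrite subr_gt0.
  apply: (derive1_quadratic_remainder (K := 2 * B / (r' - r) ^+ 2) (d := (r' - r) / 2)) => [|h hd].
    by rewrite divr_gt0.
  have zr' : disc r' z by apply: le_trans zr (ltW rr').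
  have zhr' : disc r' (z + h).
    by apply: le_trans (le_normcD _ _) _; move: zr; rewrite /disc /=; lra.
  rewrite -[X in normc X]subr0.
  apply: (normc_lim_le (u := fun n => (p n).[z + h] - (p n).[z] - h * (p n)^`().[z])).
    apply: cvgB; last by apply: cvgM (dp_cvg z zr); exact: cvg_cst.
    by apply: cvgB; exact: uniform_cvg_pointwise pf _.
  apply: filterS pB => n pnB; rewrite subr0; apply: poly_taylor1_remainder_le => // w.
  by move=> /(sphere_in_disc zr); exact: pnB.
apply/cvg_uniform_normcP => e e0; move/cvg_uniform_normcP: dp_unif => /(_ e e0).
by apply: filterS => n dpn z zr; rewrite derive1_f //; exact: dpn.
Qed.

Lemma powser_derive1 rho f a :
  powser rho f a -> powser rho (derive1 f) (fun n => n.+1%:R * a n.+1).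
Proof.
move=> fa r r0 rr; have r_lt : r < (r + rho) / 2 by lra.
have {}fa := fa _ (lt_trans r0 r_lt) ltac:(lra).
have psE : (fun n => horner (\poly_(i < n) a i)) = partial_sum a.
  by apply/funext => n; rewrite partial_sum_poly.
rewrite -psE in fa; have /cvg_uniform_normcP dfa := deriv_uniform_cvg r_lt fa.
apply/cvg_uniform_normcP => e /dfa[N _ dfan]; exists N => // n Nn z zr.
rewrite partial_sum_poly (_ : \poly_(i < n) _ = (\poly_(i < n.+1) a i)^`()); last first.
  apply/polyP => i; rewrite coef_deriv !coef_poly ltnS.
  by case: ifP => _; rewrite ?mul0rn // mulr_natl.
by apply: dfan zr; exact: leqW.
Qed.

Lemma powser_derive1n rho f a n :
  powser rho f a -> powser rho (derive1n n f) (fun m => ((m + n) ^_ n)%:R * a (m + n)%N).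
Proof.
move=> fa; elim: n => [|n IHn].
  by apply: eq_powser fa => // m; rewrite addn0 ffactn0 mul1r.
apply: eq_powser (powser_derive1 IHn) => [z _|m]; first by rewrite derive1nS.
by rewrite addSnnS mulrA -natrM mulnC ffactnSr; congr ((_ * _)%:R * _); lia.
Qed.

Lemma powser_at0 rho f a : 0 < rho -> powser rho f a -> f 0 = a 0%N.
Proof.
move=> rho0 fa; have cvg_f0 := powser_cvg (z := 0) fa ltac:(by rewrite normc0).
rewrite -(cvg_lim (@norm_hausdorff _ _) cvg_f0).
apply: cvg_lim; first exact: norm_hausdorff.
apply/cvg_normcP => e e0; exists 1%N => // -[//|n] _; rewrite seriesEord /=.
by rewrite big_ord_recl expr0 mulr1 big1 ?addr0 ?subrr ?normc0 ?ltW // => i _; rewrite expr0n mulr0.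
Qed.

Lemma powser_coefE rho f a n : 0 < rho -> powser rho f a -> a n = derive1n n f 0 / n`!%:R.
Proof.
move=> rho0 fa; rewrite (powser_at0 rho0 (powser_derive1n (n := n) fa)) add0n ffactnn.
by rewrite mulrC mulKf // pnatr_eq0 -lt0n fact_gt0.
Qed.

End Differentiation.

Section ComplexExponential.
Variable R : realType.
Implicit Types (x y : R) (z w : C R).

Definition cexp z : C R :=
  let: x +i* y := (z : R[i]) in (expR x * cos y) +i* (expR x * sin y).

Lemma cexp0 : cexp 0 = 1.
Proof. by rewrite /cexp /= expR0 cos0 sin0 mulr0 mulr1. Qed.

Lemma cexpD z w : cexp (z + w) = cexp z * cexp w.
Proof.
case: z w => [x y] [x' y']; apply/eqP; rewrite eq_complex /= expRD cosD sinD.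
by apply/andP; split; apply/eqP; ring.
Qed.

Lemma cexpMn z n : cexp (z *+ n) = cexp z ^+ n.
Proof. by elim: n => [|n IHn]; rewrite ?mulr0n ?cexp0 // mulrS cexpD IHn exprS. Qed.

Lemma cexp_real x : cexp x%:C = (expR x)%:C.
Proof. by rewrite /cexp /= cos0 sin0 mulr1 mulr0. Qed.

Lemma normc_cexp z : normc (cexp z) = expR (complex.Re (z : R[i])).
Proof.
case: z => x y /=; rewrite !exprMn -mulrDr cos2Dsin2 mulr1 sqrtr_sqr.
by rewrite ger0_norm ?expR_ge0.
Qed.

Lemma expR_taylor1_bounds x : `|x| <= 1 / 2 -> 0 <= expR x - 1 - x <= 2 * x ^+ 2.
Proof.
rewrite ler_norml => /andP[x1 x2]; have expR_lower := expR_ge1Dx x.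
have expR_upper : expR x * (1 - x) <= 1.
  by rewrite -[leRHS](expRxMexpNx_1 x) ler_pM2l ?expR_gt0 // expR_ge1Dx.
apply/andP; split; first by lra.
rewrite lerBlDr lerBlDr -(@ler_pM2r _ (1 - x)); last by lra.
apply: le_trans expR_upper _; have : 0 <= x ^+ 2 * (1 - 2 * x); last by nra.
by rewrite mulr_ge0 ?sqr_ge0 //; lra.
Qed.

Lemma sin_mean_value y : exists2 c, `|c| <= `|y| & sin y = cos c * y.
Proof.
wlog y0 : y / 0 <= y => [sin_ge0|].
  have [/sin_ge0//|/ltW y0] := leP 0 y.
  have [|c] := sin_ge0 (- y); first by rewrite oppr_ge0.
  by rewrite normrN sinN mulrN => cy /oppr_inj ->; exists c.
have sin_cont : {within `[0, y], continuous (@sin R)}.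
  exact/continuous_subspaceT/continuous_sin.
have [c] := MVT_segment y0 (fun x _ => is_derive_sin x) sin_cont.
rewrite in_itv /= => /andP[c0 cy]; rewrite sin0 !subr0 => ->.
by exists c => //; rewrite !ger0_norm.
Qed.

Lemma sin_sqr_le y : sin y ^+ 2 <= y ^+ 2.
Proof.
have [c _ ->] := sin_mean_value y.
by rewrite exprMn ler_piMl ?sqr_ge0 // -(cos2Dsin2 c) lerDl sqr_ge0.
Qed.

Lemma cos_taylor2_ge y : 1 - y ^+ 2 / 2 <= cos y.
Proof.
have -> : cos y = 1 - 2 * sin (y / 2) ^+ 2.
  by rewrite [in LHS](splitr y) -mulr2n cos_mulr2n cos2sin2 -mulr_natl; ring.
by have := sin_sqr_le (y / 2); rewrite exprMn; lra.
Qed.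

Lemma sin_taylor1_le y : `|y| <= 1 -> `|sin y - y| <= y ^+ 2 / 2.
Proof.
move=> y1; have [c cy ->] := sin_mean_value y.
have c2 : c ^+ 2 <= y ^+ 2.
  by rewrite -(real_normK (num_real c)) -(real_normK (num_real y)) lerXn2r ?nnegrE.
have cos_near1 : `|cos c - 1| <= y ^+ 2 / 2.
  by have := cos_le1 c; have := cos_taylor2_ge c => cos_lower cos_upper; rewrite ler0_norm; lra.
have -> : cos c * y - y = (cos c - 1) * y by ring.
by rewrite normrM -[leRHS]mulr1; apply: ler_pM.
Qed.

Lemma cexp_imaginary_taylor1_le y :
  `|y| <= 1 -> normc (cexp (0 +i* y) - 1 - (0 +i* y)) <= y ^+ 2.
Proof.
move=> y1; apply: le_trans (normc_le_ReIm _) _.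
rewrite /= expR0 !mul1r !subr0.
have := sin_taylor1_le y1; have := cos_le1 y; have := cos_taylor2_ge y => cos_lower cos_upper.
by rewrite (@ler0_norm _ (cos y - 1)); lra.
Qed.

Lemma cexp_taylor1_le z : normc z <= 1 / 2 -> normc (cexp z - 1 - z) <= 3 * normc z ^+ 2.
Proof.
move=> z1; have := le_trans (Re_le_normc z) z1; have := le_trans (Im_le_normc z) z1.
rewrite sqr_normcE; set x := complex.Re _; set y := complex.Im _ => y1 x1.
have /andP[expR_lower expR_upper] := expR_taylor1_bounds x1.
have expR1_le : `|expR x - 1| <= 2 * `|x|.
  have -> : expR x - 1 = expR x - 1 - x + x by ring.
  have x2 : 2 * x ^+ 2 <= `|x| by rewrite -(real_normK (num_real x)); have := normr_ge0 x; nra.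
  by apply: le_trans (ler_normD _ _) _; rewrite ger0_norm; lra.
have expR_le2 : expR x <= 2.
  by move: expR1_le; rewrite ler_norml; lra.
pose X : C R := x%:C; pose Y : C R := 0 +i* y.
have -> : z = X + Y by rewrite /X /Y /x /y; case: (z) => a b; simpc.
have -> : cexp (X + Y) - 1 - (X + Y) =
    (expR x - 1 - x)%:C + (expR x)%:C * (cexp Y - 1 - Y) + (expR x - 1)%:C * Y.
  by rewrite cexpD cexp_real !rmorphB rmorph1 -/X; ring.
have imag : normc (cexp Y - 1 - Y) <= y ^+ 2 by apply: cexp_imaginary_taylor1_le; lra.
apply: le_trans (le_normcD _ _) _; apply: le_trans (lerD (le_normcD _ _) (lexx _)) _.
rewrite !normcM !normc_real normc_imaginary (ger0_norm expR_lower) ger0_norm ?expR_ge0 //.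
have := ler_pM (expR_ge0 x) (normc_ge0 _) expR_le2 imag.
have := ler_wpM2r (normr_ge0 y) expR1_le.
have := sqr_ge0 (`|x| - `|y|); rewrite sqrrB !real_normK ?num_real //; lra.
Qed.

Lemma normc_subXX_le (z w : C R) (B : R) n : normc z <= B -> normc w <= B ->
  normc (z ^+ n - w ^+ n) <= normc (z - w) * (n%:R * B ^+ n.-1).
Proof.
move=> zB wB; rewrite subrXX normcM ler_wpM2l ?normc_ge0 //.
apply: le_trans (normc_sum _ _ _) _; rewrite mulr_natl -[X in _ *+ X](card_ord n) -sumr_const.
apply: ler_sum => i _; rewrite normcM !normcX.
have -> : B ^+ n.-1 = B ^+ (n.-1 - i) * B ^+ i by rewrite -exprD subnK //; have := ltn_ord i; lia.
have B0 : 0 <= B := le_trans (normc_ge0 z) zB.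
by apply: ler_pM; rewrite ?exprn_ge0 ?normc_ge0 // lerXn2r ?nnegrE ?normc_ge0.
Qed.

Lemma expr1D_cexp_dist_le z r n : (0 < n)%N -> 2 * r <= n%:R -> normc z <= r ->
  normc ((1 + z / n%:R) ^+ n - cexp z) <= 3 * r ^+ 2 * expR r / n%:R.
Proof.
move=> n_gt0 rn zr; have n0 : 0 < n%:R :> R by rewrite ltr0n.
have r0 : 0 <= r := le_trans (normc_ge0 z) zr.
have {2}-> : z = (z / n%:R) *+ n by rewrite -mulr_natr divfK // pnatr_eq0 -lt0n.
rewrite cexpMn; set w := z / n%:R; set B := expR (r / n%:R).
have wr : normc w <= r / n%:R by rewrite normcM normcV normc_nat ler_pM2r // invr_gt0.
have w_half : normc w <= 1 / 2 by apply: le_trans wr _; rewrite ler_pdivrMr //; lra.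
have cexpB : normc (cexp w) <= B.
  rewrite normc_cexp ler_expR; apply: le_trans wr; apply: le_trans (Re_le_normc w).
  exact: ler_norm.
have linB : normc (1 + w) <= B.
  by apply: le_trans (expR_ge1Dx _); apply: le_trans (le_normcD _ _) _; rewrite normc1 lerD2l.
have close : normc (1 + w - cexp w) <= 3 * (r / n%:R) ^+ 2.
  rewrite normc_distC opprD addrA; apply: le_trans (cexp_taylor1_le w_half) _.
  by rewrite ler_pM2l // lerXn2r ?nnegrE ?normc_ge0 // divr_ge0 // ltW.
have B1 : 1 <= B by rewrite /B -expR0 ler_expR divr_ge0 // ltW.
have Bn : B ^+ n.-1 <= expR r.
  have <- : B ^+ n = expR r by rewrite -expRM_natr divfK // lt0r_neq0.
  by rewrite ler_weXn2l // leq_pred.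
apply: le_trans (normc_subXX_le n linB cexpB) _.
have -> : 3 * r ^+ 2 * expR r / n%:R = 3 * (r / n%:R) ^+ 2 * (n%:R * expR r).
  by field; rewrite lt0r_neq0.
by apply: ler_pM; rewrite ?normc_ge0 ?mulr_ge0 ?exprn_ge0 ?expR_ge0 // ler_pM2l.
Qed.

Lemma poly_approx_cexp r : 0 <= r -> poly_approx (disc r) cexp.
Proof.
move=> r0 e e0; pose A := 3 * r ^+ 2 * expR r; pose n := (Num.truncn (2 * r + A / e)).+1.
have A0 : 0 <= A by rewrite !mulr_ge0 ?expR_ge0.
have nA : 2 * r + A / e < n%:R by exact: truncnS_gt.
have Ae0 : 0 <= A / e by rewrite divr_ge0 // ltW.
exists ((1 + n%:R^-1 *: 'X) ^+ n) => z zr.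
rewrite horner_exp hornerD hornerZ hornerX hornerC [_ * z]mulrC.
apply: le_trans (expr1D_cexp_dist_le _ _ zr) _ => //; first by lra.
by rewrite -/A ler_pdivrMr ?ltr0n // mulrC -ler_pdivrMr //; lra.
Qed.

End ComplexExponential.

Section ZetaApproximation.
Variable R : realType.
Implicit Types (s z c : C R) (x y delta M : R).

Lemma cpowE x z : cpow x z = cexp (z * (ln x)%:C).
Proof. by case: z => a b; rewrite /cpow /cexp /= !mulr0 subr0 add0r. Qed.

Lemma cpowr0 x : cpow x (0 : C R) = 1.
Proof. by rewrite cpowE mul0r cexp0. Qed.

Lemma normc_cpow x z : 0 < x -> normc (cpow x z) = x `^ complex.Re (z : R[i]).
Proof.
move=> x0; rewrite cpowE normc_cexp /powR gt_eqF //.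
by case: z => a b /=; rewrite mulr0 subr0.
Qed.

(* [s - 1] times the sequence whose limit is [zeta s]; unlike the latter, it
   makes sense at the pole, where it is constantly [1]. *)
Definition zeta_partial (n : nat) s : C R :=
  (s - 1) * \sum_(1 <= i < n.+1) cpow (i%:R : R) (- s) + cpow (n%:R : R) (1 - s).

Lemma ln1B_natSV n : (0 < n)%N -> ln (1 - n.+1%:R^-1) = ln n%:R - ln n.+1%:R :> R.
Proof.
move=> n0; rewrite -ln_div ?posrE ?ltr0n //; congr ln.
by rewrite -natr1; field; rewrite natr1 pnatr_eq0.
Qed.

Lemma zeta_partialS n s : (0 < n)%N ->
  zeta_partial n.+1 s - zeta_partial n s =
  cpow (n.+1%:R : R) (1 - s) *
  (1 - (1 - s) / n.+1%:R - cexp ((1 - s) * (ln (1 - n.+1%:R^-1 : R))%:C)).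
Proof.
move=> n0; have nC : (n.+1%:R : C R) != 0 by rewrite pnatr_eq0.
rewrite /zeta_partial big_nat_recr //= !cpowE ln1B_natSV //.
set S := \sum_(1 <= i < n.+1) _; set L := ln n.+1%:R.
have -> : cexp (- s * L%:C) = cexp ((1 - s) * L%:C) / n.+1%:R.
  have cexp_L : cexp L%:C = n.+1%:R by rewrite cexp_real lnK ?posrE ?ltr0n // rmorph_nat.
  by apply: (mulIf nC); rewrite divfK // -cexp_L -cexpD; congr cexp; ring.
have -> : cexp ((1 - s) * (ln n%:R)%:C) =
    cexp ((1 - s) * L%:C) * cexp ((1 - s) * (ln n%:R - L)%:C).
  by rewrite -cexpD rmorphB /=; congr cexp; ring.
ring.
Qed.

Lemma ln1B_bounds y : 0 <= y -> y <= 1 / 2 -> - y - 2 * y ^+ 2 <= ln (1 - y) <= - y.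
Proof.
move=> y0 y1; have p : 0 < 1 - y by lra.
apply/andP; split; last by apply: le_ln1Dx; lra.
rewrite -[1 - y]invrK lnV ?posrE ?invr_gt0 //.
have -> : (1 - y)^-1 = 1 + y / (1 - y) by field; rewrite lt0r_neq0.
have : ln (1 + y / (1 - y)) <= y / (1 - y).
  by apply: le_ln1Dx; apply: lt_le_trans (divr_ge0 y0 (ltW p)); lra.
have : y / (1 - y) <= y + 2 * y ^+ 2 by rewrite ler_pdivrMr //; nra.
lra.
Qed.

Lemma cexp_ln1B_le c y M : 0 <= y -> y <= 1 / 2 -> normc c <= M -> 4 * M * y <= 1 ->
  normc (1 - c * y%:C - cexp (c * (ln (1 - y))%:C)) <= (12 * M ^+ 2 + 2 * M) * y ^+ 2.
Proof.
move=> y0 y1 cM My; have /andP[lnl lnu] := ln1B_bounds y0 y1.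
have M0 : 0 <= M := le_trans (normc_ge0 c) cM.
have y2 : 2 * y ^+ 2 <= y by nra.
set v := c * (ln _)%:C; have vM : normc v <= M * (2 * y).
  by rewrite /v normcM normc_real; apply: ler_pM; rewrite ?normc_ge0 // ler0_norm; lra.
have -> : 1 - c * y%:C - cexp v = - (cexp v - 1 - v) - c * (ln (1 - y) + y)%:C.
  by rewrite rmorphD mulrDr -/v; ring.
apply: le_trans (normcB _ _) _; rewrite normcN normcM normc_real.
have quad : normc (cexp v - 1 - v) <= 3 * (M * (2 * y)) ^+ 2.
  apply: le_trans (cexp_taylor1_le _) _; first by lra.
  by rewrite ler_pM2l // lerXn2r ?nnegrE ?normc_ge0 // (le_trans (normc_ge0 v)).
have lin : normc c * `|ln (1 - y) + y| <= M * (2 * y ^+ 2).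
  by apply: ler_pM; rewrite ?normc_ge0 // ler0_norm; lra.
by lra.
Qed.

Lemma powRN_sub_ge n delta : (0 < n)%N -> 0 < delta ->
  (n.+1%:R : R) `^ (- delta) / n.+1%:R <=
  delta^-1 * (n%:R `^ (- delta) - n.+1%:R `^ (- delta)).
Proof.
move=> n0 d0; have n_gt0 : 0 < n%:R :> R by rewrite ltr0n.
have S_gt0 : 0 < n.+1%:R :> R by rewrite ltr0n.
rewrite /powR !gt_eqF // [leRHS]mulrC ler_pdivlMr //.
set L := ln n.+1%:R; set l := ln n%:R.
have L_l : n.+1%:R^-1 <= L - l.
  rewrite -opprB -ln1B_natSV // lerNr.
  by apply: le_ln1Dx; rewrite ltrN2 invf_lt1 // (ltr_nat _ 1).
have -> : - delta * l = - delta * L + delta * (L - l) by ring.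
rewrite expRD -[X in _ <= _ - X]mulr1 -mulrBr -mulrA ler_pM2l ?expR_gt0 // mulrC.
by rewrite lerBrDl; apply: le_trans (expR_ge1Dx _); rewrite lerD2l ler_pM2l.
Qed.

Lemma powRN_cvg0 delta : 0 < delta -> (fun n => n%:R `^ (- delta) : R) @ \oo --> (0 : R).
Proof.
move=> d0; apply/cvgrPdist_le => e e0.
have einv : (e^-1 `^ delta^-1) `^ delta = e^-1.
  by rewrite -powRrM mulVf ?lt0r_neq0 // powRr1 // invr_ge0 ltW.
have near_ge := nbhs_infty_ger (e^-1 `^ delta^-1).
near=> n.
have ne : e^-1 `^ delta^-1 <= n%:R by near: n.
rewrite sub0r normrN ger0_norm ?powR_ge0 // powRN -[e]invrK lef_pV2 ?posrE ?invr_gt0 //.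
  by rewrite -einv ge0_ler_powR ?nnegrE ?powR_ge0 // ltW.
by rewrite powR_gt0 // (lt_le_trans _ ne) // powR_gt0 // invr_gt0.
Unshelve. all: by end_near. Qed.

Definition halfplane_disc delta M : set (C R) :=
  [set s | delta <= complex.Re (s : R[i]) /\ normc (1 - s) <= M].

Lemma zeta_partialS_dist_le delta M s n : 0 < delta -> (0 < n)%N -> 4 * M <= n.+1%:R ->
  halfplane_disc delta M s ->
  normc (zeta_partial n.+1 s - zeta_partial n s) <=
  (12 * M ^+ 2 + 2 * M) / delta * (n%:R `^ (- delta) - n.+1%:R `^ (- delta)).
Proof.
move=> d0 n0 nM [sd sM]; have M0 := le_trans (normc_ge0 _) sM.
have S_gt0 : 0 < n.+1%:R :> R by rewrite ltr0n.
have S_ge1 : 1 <= n.+1%:R :> R by rewrite (ler_nat R 1).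
rewrite (zeta_partialS s n0) normcM normc_cpow //.
have cpow_le : n.+1%:R `^ complex.Re (1 - s : R[i]) <= n.+1%:R * n.+1%:R `^ (- delta).
  have -> : n.+1%:R * n.+1%:R `^ (- delta) = n.+1%:R `^ (1 - delta) :> R.
    by rewrite powRD ?pnatr_eq0 ?implybT // powRr1 // ltW.
  by apply: ler_powR => //; rewrite raddfB /=; lra.
have bracket_le : normc (1 - (1 - s) / n.+1%:R - cexp ((1 - s) * (ln (1 - n.+1%:R^-1))%:C)) <=
    (12 * M ^+ 2 + 2 * M) * n.+1%:R^-1 ^+ 2.
  have -> : (n.+1%:R^-1 : C R) = (n.+1%:R^-1)%:C by rewrite fmorphV rmorph_nat.
  apply: cexp_ln1B_le => //.
  - by rewrite mul1r lef_pV2 ?posrE // (ler_nat R 2).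
  - by rewrite ler_pdivrMr // mul1r.
apply: le_trans (ler_pM _ (normc_ge0 _) cpow_le bracket_le) _; first exact: powR_ge0.
set K := 12 * _ + _; have K0 : 0 <= K by rewrite addr_ge0 ?mulr_ge0 // sqr_ge0.
set P := _ `^ _; have -> : n.+1%:R * P * (K * n.+1%:R^-1 ^+ 2) = K * (P / n.+1%:R).
  by field; rewrite lt0r_neq0.
by rewrite -mulrA ler_wpM2l // powRN_sub_ge.
Qed.

Lemma zeta_partial_dist_le delta M s n m : 0 < delta -> (0 < n)%N -> 4 * M <= n%:R ->
  halfplane_disc delta M s -> (n <= m)%N ->
  normc (zeta_partial m s - zeta_partial n s) <=
  (12 * M ^+ 2 + 2 * M) / delta * n%:R `^ (- delta).
Proof.
move=> d0 n0 nM sM nm; have M0 := le_trans (normc_ge0 _) sM.2.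
set K := _ / delta.
have K0 : 0 <= K by rewrite divr_ge0 ?addr_ge0 ?mulr_ge0 ?sqr_ge0 // ltW.
suff : normc (zeta_partial m s - zeta_partial n s) <=
    K * (n%:R `^ (- delta) - m%:R `^ (- delta)).
  by move=> /le_trans; apply; apply: ler_wpM2l => //; rewrite gerBl powR_ge0.
elim: m nm => [|m IHm]; first by rewrite leqn0 => /eqP ->; rewrite !subrr mulr0 normc0.
rewrite leq_eqVlt => /predU1P[<-|]; first by rewrite !subrr mulr0 normc0.
rewrite ltnS => nm; apply: le_trans (normc_distD (zeta_partial m s) _ _) _.
have mM : 4 * M <= m.+1%:R by apply: le_trans nM _; rewrite ler_nat leqW.
have := zeta_partialS_dist_le d0 (leq_trans n0 nm) mM sM; have := IHm nm.
by rewrite -/K; lra.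
Qed.

Lemma zeta_partial_uniform_cauchy delta M : 0 < delta ->
  uniform_cauchy (halfplane_disc delta M) zeta_partial.
Proof.
move=> d0 e e0; pose K := (12 * M ^+ 2 + 2 * M) / delta.
have K1 : 0 < `|K| + 1 by rewrite ltr_wpDl.
move/cvgrPdist_le: (powRN_cvg0 d0) => /(_ _ (divr_gt0 e0 K1)) small.
near=> N => n s Nn sM.
have N0 : (0 < N)%N by near: N; exact: nbhs_infty_gt.
have NM : 4 * M <= N%:R by near: N; exact: nbhs_infty_ger.
apply: le_trans (zeta_partial_dist_le d0 N0 NM sM Nn) _.
have : `|0 - N%:R `^ (- delta)| <= e / (`|K| + 1) by near: N.
rewrite sub0r normrN ger0_norm ?powR_ge0 // ler_pdivlMr //; apply: le_trans.
by rewrite mulrC ler_wpM2l ?powR_ge0 // -/K (le_trans (ler_norm K)) // lerDl.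
Unshelve. all: by end_near. Qed.

Lemma lim_zeta_partial delta s : 0 < delta -> delta <= complex.Re (s : R[i]) ->
  limn (zeta_partial^~ s) = zetak_reg 1 s.
Proof.
move=> d0 sd; have cvg_zeta : cvgn (zeta_partial^~ s).
  have [+ _] := uniform_cauchy_cvg (@zeta_partial_uniform_cauchy _ (normc (1 - s)) d0).
  by apply; split.
rewrite /zetak_reg; case: eqVneq => [s1|s1].
  apply: cvg_lim; first exact: norm_hausdorff.
  rewrite s1 (_ : zeta_partial^~ 1 = cst 1); first exact: cvg_cst.
  by apply/funext => n; rewrite /zeta_partial subrr mul0r add0r cpowr0.
have sub1s_neq0 : s - 1 != 0 by rewrite subr_eq0.
suff -> : zeta s = (s - 1)^-1 * limn (zeta_partial^~ s) by rewrite expr1 mulVKf.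
apply: cvg_lim; first exact: norm_hausdorff.
rewrite (_ : (fun N : nat => _) = fun n => (s - 1)^-1 * zeta_partial n s); last first.
  apply/funext => n; rewrite /zeta_partial mulrDr mulKf //; congr (_ + _).
  by rewrite -mulrN -invrN opprB mulrC.
by apply: cvgM cvg_zeta; exact: cvg_cst.
Qed.

Lemma poly_approx_cpow x r : poly_approx (disc r) (cpow x).
Proof.
have poly_approx_lin : poly_approx (disc r) (fun z => z * (ln x)%:C).
  by apply: poly_approxM; [exact: poly_approx_id | exact: poly_approx_cst].
have [B B0 linB] := poly_approx_bounded poly_approx_lin.
apply: eq_poly_approx (poly_approx_comp (poly_approx_cexp (ltW B0)) poly_approx_lin linB).
by move=> z _; rewrite /= cpowE.
Qed.

Lemma poly_approx_zeta_partial n r : poly_approx (disc r) (zeta_partial n).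
Proof.
have poly_approx_affine a b : poly_approx (disc r) (fun s => a * s + b).
  apply: poly_approxD (poly_approx_cst _ _).
  by apply: poly_approxM (poly_approx_id _); exact: poly_approx_cst.
have poly_approx_cpow_affine x a b : poly_approx (disc r) (fun s => cpow x (a * s + b)).
  have [B _ affineB] := poly_approx_bounded (poly_approx_affine a b).
  exact: poly_approx_comp (@poly_approx_cpow x B) _ affineB.
apply: poly_approxD.
- apply: poly_approxM.
    by apply: eq_poly_approx (poly_approx_affine 1 (- 1)) => s _; rewrite mul1r.
  apply: poly_approx_sum => i.
  by apply: eq_poly_approx (poly_approx_cpow_affine i%:R (- 1) 0) => s _; rewrite mulN1r addr0.
- by apply: eq_poly_approx (poly_approx_cpow_affine n%:R (- 1) 1) => s _; rewrite mulN1r addrC.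
Qed.

Lemma poly_approx_zetak_reg1 delta M : 0 < delta ->
  poly_approx (halfplane_disc delta M) (zetak_reg 1).
Proof.
move=> d0; have [_ unif] := uniform_cauchy_cvg (@zeta_partial_uniform_cauchy _ M d0).
apply: (@eq_poly_approx _ _ (fun s => limn (zeta_partial^~ s))) => [s /set_mem[sd _]|].
  exact: lim_zeta_partial sd.
apply: poly_approx_lim unif => n e e0.
have [p pn] := poly_approx_zeta_partial n (1 + M) e0; exists p => s [_ sM].
apply: pn; rewrite /disc /= -[s](subKr 1).
by apply: le_trans (normcB _ _) _; rewrite normc1 lerD2l.
Qed.

Lemma poly_approx_zetak_reg k delta (g : C R -> C R) r : 0 < delta ->
  poly_approx (disc r) g ->
  (forall z, disc r z -> delta <= complex.Re (g z : R[i])) ->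
  poly_approx (disc r) (fun z => zetak_reg k (g z)).
Proof.
move=> d0 Hg gd; have [B B0 gB] := poly_approx_bounded Hg.
have g_region z : disc r z -> halfplane_disc delta (1 + B) (g z).
  move=> zr; split; first exact: gd.
  by apply: le_trans (normcB _ _) _; rewrite normc1 lerD2l gB.
have := poly_approxX k (poly_approx_comp (@poly_approx_zetak_reg1 _ (1 + B) d0) Hg g_region).
apply: eq_poly_approx => z _.
by rewrite /= /zetak_reg; case: eqP => _; rewrite ?expr1n ?expr1.
Qed.

End ZetaApproximation.

Section ChangeOfVariable.
Variable R : realType.
Implicit Types (f : C R -> C R) (a b c : nat -> C R) (rho r : R) (z : C R).

Lemma poly_approx_1B S : poly_approx S (fun z : C R => 1 - z).
Proof. by apply: eq_poly_approx (poly_approx_horner S (1 - 'X)) => z _; rewrite !hornerE. Qed.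

Lemma powser_divr1B rho f a : 0 < rho -> rho <= 1 -> powser rho f a ->
  powser rho (fun z => f z / (1 - z)) (fun n => \sum_(i < n.+1) a i).
Proof.
move=> rho0 rho1 fa; have [|b gb] := @analytic_powser _ rho (fun z => f z / (1 - z)).
  move=> r r0 rr; apply: poly_approxM; first exact: powser_analytic fa _ r0 rr.
  by apply: poly_approx_inv1B; [exact: ltW | exact: lt_le_trans rho1].
apply: eq_powser (gb) => // n.
have a_b : a =1 (fun m => b m + -1 * (if m is m'.+1 then b m' else 0)).
  apply: (powser_uniq rho0 fa (powserD gb (powserZ (c := -1) (powserMX gb)))) => z zr /=.
  by field; apply: subr1_neq0; exact: lt_le_trans rho1.
elim: n => [|n IHn]; first by rewrite big_ord1 a_b mulr0 addr0.
by rewrite big_ord_recr -IHn /= a_b; ring.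
Qed.

Definition mobius_mono k j : C R -> C R := fun z => z ^+ j * (1 - z) ^+ k / (1 - z) ^+ j.

(* The coefficient of [z ^+ m] in [mobius_mono k j], by the binomial series of
   [(1 - z) ^ (k - j)] if [j <= k] and by the negative binomial series otherwise. *)
Definition mobius_coef k j m : C R :=
  if (m < j)%N then 0
  else if (j <= k)%N then (-1) ^+ (m - j) * 'C(k - j, m - j)%:R
  else 'C(m - k.+1, j - k.+1)%:R.

Definition mobius_transform k c m : C R := \sum_(i < m.+1) c i * mobius_coef k i m.

Lemma mobius_coefS k j m :
  mobius_coef k j.+1 m.+1 = mobius_coef k j.+1 m + mobius_coef k j m.
Proof.
rewrite /mobius_coef ltnS subSS; case: ltngtP => [mj|jm|<-].
- by rewrite (ltn_trans mj) // add0r.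
- rewrite (ltnNge m) jm /= !subSS; have [jk|kj|<-] := ltngtP j k.
  + have -> : (k - j = (k - j.+1).+1)%N by lia.
    have -> : (m - j = (m - j.+1).+1)%N by lia.
    by rewrite binS natrD exprS; ring.
  + have -> : (m - k = (m - k.+1).+1)%N by lia.
    have -> : (j - k = (j - k.+1).+1)%N by lia.
    by rewrite binS natrD.
  + by rewrite !subnn !bin0 bin_small ?mulr0 ?addr0 //; lia.
- rewrite ltnSn add0r !subnn !bin0 expr0 mulr1 subSS.
  by have [mk|km|<-] := ltngtP m k; rewrite ?binn ?bin0 ?mulr1.
Qed.

Lemma sum_mobius_coef k j m : \sum_(i < m) mobius_coef k j i = mobius_coef k j.+1 m.
Proof.
elim: m => [|m IHm]; first by rewrite big_ord0.
by rewrite big_ord_recr /= IHm mobius_coefS.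
Qed.

Lemma coef_exp1BX k m : ((1 - 'X : {poly C R}) ^+ k)`_m = (-1) ^+ m * 'C(k, m)%:R.
Proof.
elim: k m => [|k IHk] m.
  by rewrite expr0 coef1 bin0n; case: m => [|m]; rewrite /= ?expr0 ?mulr1 ?mulr0.
rewrite exprS mulrBl mul1r coefB coefXM !IHk; case: m => [|m] /=.
  by rewrite !bin0 subr0.
by rewrite binS natrD exprS; ring.
Qed.

Lemma powser_mobius_mono k j : powser 1 (mobius_mono k j) (mobius_coef k j).
Proof.
elim: j => [|j IHj].
  apply: eq_powser (@powser_horner _ 1 ((1 - 'X) ^+ k)) => [z _|m].
    by rewrite /mobius_mono !expr0 mul1r divr1 horner_exp !hornerE.
  by rewrite /mobius_coef ltn0 leq0n !subn0 coef_exp1BX.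
have powser_shift := powserMX (powser_divr1B ltr01 (lexx 1) IHj).
apply: eq_powser powser_shift => [z z1|[|m]]; rewrite ?sum_mobius_coef //.
by have nz := subr1_neq0 z1; rewrite /mobius_mono !exprS; field; rewrite ?expf_neq0 ?nz.
Qed.

Lemma normc_inv1B_sub1 z r : r < 1 -> normc z <= r -> normc ((1 - z)^-1 - 1) <= r / (1 - r).
Proof.
move=> r1 zr; have nz : 1 - z != 0 by apply: subr1_neq0; exact: le_lt_trans r1.
have -> : (1 - z)^-1 - 1 = z / (1 - z) by field.
have y0 : 0 < 1 - r by lra.
rewrite normcM normcV; apply: ler_pM; rewrite ?invr_ge0 ?normc_ge0 //.
rewrite lef_pV2 ?posrE ?normc_gt0 //.
by have := normc_distD z 1 0; rewrite !subr0 normc1; lra.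
Qed.

Lemma sum_mobius_mono k c n z : 1 - z != 0 ->
  \sum_(i < n) c i * mobius_mono k i z = (1 - z) ^+ k * partial_sum c n ((1 - z)^-1 - 1).
Proof.
move=> nz; rewrite mulr_sumr; apply: eq_bigr => i _.
have -> : (1 - z)^-1 - 1 = z / (1 - z) by field.
by rewrite exprMn exprVn /mobius_mono; ring.
Qed.

Lemma sum_mobius_mono_cvg rho k f c r : 0 < rho -> powser rho f c -> 0 < r -> r < rho / (1 + rho) ->
  {uniform disc r, (fun n z => \sum_(i < n) c i * mobius_mono k i z) @ \oo -->
    (fun z => (1 - z) ^+ k * f ((1 - z)^-1 - 1))}.
Proof.
move=> rho0 fc r0 rr; have r1 : r < 1 by move: rr; rewrite ltr_pdivlMr; nra.
have y0 : 0 < 1 - r by lra.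
have t0 : 0 < r / (1 - r) by rewrite divr_gt0.
have tr : r / (1 - r) < rho.
  by rewrite ltr_pdivrMr //; move: rr; rewrite ltr_pdivlMr; lra.
apply/cvg_uniform_normcP => e e0; have two_k : 0 < 2 ^+ k :> R by rewrite exprn_gt0.
move/cvg_uniform_normcP: (fc _ t0 tr) => /(_ _ (divr_gt0 e0 two_k)).
apply: filterS => n fcn z zr; have z1 : normc z < 1 := le_lt_trans zr r1.
rewrite sum_mobius_mono ?subr1_neq0 // -mulrBr normcM normcX.
rewrite -[e](divfK (lt0r_neq0 two_k)) mulrC; apply: ler_pM; rewrite ?exprn_ge0 ?normc_ge0 //.
  by apply: fcn; exact: normc_inv1B_sub1.
rewrite lerXn2r ?nnegrE ?normc_ge0 //.
by have := normcB 1 z; rewrite normc1; lra.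
Qed.

(* The variables are related by [1 + t = (1 - z)^-1], that is [t = z / (1 - z)]. *)
Lemma powser_mobius rho k f c b : 0 < rho -> powser rho f c ->
  powser 1 (fun z => (1 - z) ^+ k * f ((1 - z)^-1 - 1)) b ->
  b =1 mobius_transform k c.
Proof.
move=> rho0 fc Gb m; pose A n m := \sum_(i < n) c i * mobius_coef k i m.
have rho'0 : 0 < rho / (1 + rho) by rewrite divr_gt0 // addr_gt0.
have rho'1 : rho / (1 + rho) <= 1 by rewrite ler_pdivrMr; lra.
have FA n : powser (rho / (1 + rho)) (fun z => \sum_(i < n) c i * mobius_mono k i z) (A n).
  have term i : powser (rho / (1 + rho))
      (fun z => c i * mobius_mono k i z) (fun m => c i * mobius_coef k i m).
    by apply: powserZ; apply: sub_powser rho'1 _; exact: powser_mobius_mono.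
  exact: powser_sum term.
have Ff r := @sum_mobius_mono_cvg rho k f c r rho0 fc.
have -> : b m = limn (A^~ m).
  exact: (powser_uniq rho'0 (sub_powser rho'1 Gb) (powser_lim rho'0 FA Ff)).
apply: cvg_lim; first exact: norm_hausdorff.
apply/cvg_normcP => e e0; exists m.+1 => // n /= mn.
rewrite /A -(subnKC mn) big_split_ord /= [X in _ + X - _]big1 => [|i _].
  by rewrite addr0 subrr normc0 ltW.
by rewrite /mobius_coef addSn ltnS leq_addr mulr0.
Qed.

End ChangeOfVariable.

Section ZetaPowers.
Variable R : realType.
Implicit Types (z s : C R).

Lemma Re_inv1B_ge z : normc z < 1 -> 2^-1 <= complex.Re ((1 - z)^-1 : R[i]).
Proof.
move=> z1; have : 0 < normc (1 - z) ^+ 2 by rewrite exprn_gt0 // normc_gt0 // subr1_neq0.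
have : normc z ^+ 2 < 1 by rewrite expr_lt1 ?normc_ge0.
rewrite !sqr_normcE; case: z {z1} => x y /=; rewrite sub0r sqrrN => sqr_lt1 sqr_gt0.
by rewrite ler_pdivlMr //; lra.
Qed.

Lemma analytic_zetak_reg_1D k : analytic_on 1 (fun t : C R => zetak_reg k (1 + t)).
Proof.
move=> r r0 r1; apply: (@poly_approx_zetak_reg R k (1 - r) (fun t => 1 + t)).
- by lra.
- by apply: poly_approxD; [exact: poly_approx_cst | exact: poly_approx_id].
move=> t; rewrite /disc /= raddfD /= => tr; have := Re_le_normc t.
by rewrite ler_norml => /andP[]; lra.
Qed.

Lemma analytic_zetak_reg_inv1B k :
  analytic_on 1 (fun z : C R => (1 - z) ^+ k * zetak_reg k ((1 - z)^-1)).
Proof.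
move=> r r0 r1; apply: poly_approxM; first by apply: poly_approxX; exact: poly_approx_1B.
apply: (@poly_approx_zetak_reg R k 2^-1 (fun z => (1 - z)^-1)) => //.
- exact: poly_approx_inv1B (ltW r0) r1.
- by move=> z zr; apply: Re_inv1B_ge; exact: le_lt_trans r1.
Qed.

Lemma powser_lambda k :
  powser 1 (fun t : C R => zetak_reg k (1 + t)) (fun j => lambda R j k / j`!%:R).
Proof.
have [a fa] := analytic_powser (@analytic_zetak_reg_1D k).
apply: eq_powser (fa) => // j; rewrite (powser_coefE _ ltr01 fa).
by rewrite derive1n_shift addr0.
Qed.

Lemma ell_mobius_transform_le k m : (m <= k)%N ->
  (-1) ^ (m%:Z - k%:Z) * ell R (m%:Z - k%:Z) k =
  mobius_transform k (fun j => lambda R j k / j`!%:R) m.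
Proof.
move=> mk; rewrite /mobius_transform.
rewrite -(big_mkord xpredT (fun i => lambda R i k / i`!%:R * mobius_coef R k i m)).
have -> : m%:Z - k%:Z = - (k - m)%:Z by rewrite -subzn // opprB.
rewrite /ell oppr_gt0 ltNge /= abszN /= subKn // mulrA.
have -> : (-1) ^ (- (k - m)%:Z) * (-1) ^+ k = (-1) ^+ m :> C R.
  by rewrite -invr_expz -exprnP -{2}(subnK mk) exprD mulKf // signr_eq0.
rewrite mulr_sumr; apply: eq_big_nat => i /andP[_]; rewrite ltnS => im.
rewrite /mobius_coef ltnNge im /= (leq_trans im mk) -bin_sub; last by lia.
have -> : (k - i - (k - m) = m - i)%N by lia.
have -> : (-1) ^+ m = (-1) ^+ (m - i) * (-1) ^+ i :> C R by rewrite -exprD subnK.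
set e := (-1) ^+ i; have ee : e * e = 1 by rewrite -expr2 sqrr_sign.
by rewrite -[RHS]mul1r -[X in _ = X * _]ee; ring.
Qed.

Lemma ell_mobius_transform_gt k m : (k < m)%N ->
  (-1) ^ (m%:Z - k%:Z) * ell R (m%:Z - k%:Z) k =
  mobius_transform k (fun j => lambda R j k / j`!%:R) m.
Proof.
move=> km; rewrite /mobius_transform.
rewrite -(big_mkord xpredT (fun i => lambda R i k / i`!%:R * mobius_coef R k i m)).
have -> : m%:Z - k%:Z = (m - k)%:Z by rewrite subzn // ltnW.
have -> : ell R (m - k)%:Z k = (-1) ^+ (m - k) *
    \sum_(1 <= j < (m - k).+1) 'C((m - k).-1, j.-1)%:R * lambda R (j + k) k / (j + k)`!%:R.
  by rewrite /ell ltz_nat subn_gt0 km.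
rewrite -exprnP mulrA -expr2 sqrr_sign mul1r.
rewrite [RHS](big_cat_nat (n := k.+1)) ?ltnS ?(ltnW km) //= [X in _ = X + _]big_nat_cond.
rewrite [X in _ = X + _]big1 ?add0r => [|i /andP[/andP[_ ik] _]]; last first.
  rewrite ltnS in ik; rewrite /mobius_coef ltnNge (leq_trans ik (ltnW km)) /= ik.
  by rewrite bin_small ?mulr0 //; lia.
rewrite -[k.+1]add1n big_addn subSn 1?ltnW //; apply: eq_big_nat => j /andP[j1 jm].
rewrite /mobius_coef ifF; last by apply/negbTE; rewrite -leqNgt; lia.
rewrite ifF; last by apply/negbTE; rewrite -ltnNge; lia.
have -> : (m - k.+1 = (m - k).-1)%N by lia.
have -> : (j + k - k.+1 = j.-1)%N by lia.
by rewrite [RHS]mulrC mulrA.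
Qed.

Lemma powser_ell k :
  powser 1 (fun z : C R => (1 - z) ^+ k * zetak_reg k ((1 - z)^-1))
    (fun m => (-1) ^ (m%:Z - k%:Z) * ell R (m%:Z - k%:Z) k).
Proof.
have [b gb] := analytic_powser (@analytic_zetak_reg_inv1B k).
apply: eq_powser (gb) => // m.
have -> : b m = mobius_transform k (fun j => lambda R j k / j`!%:R) m.
  apply: (powser_mobius ltr01 (@powser_lambda k)).
  by apply: eq_powser gb => // z _; rewrite [1 + (_ - 1)]addrC subrK.
by have [mk|km] := leqP m k; [rewrite ell_mobius_transform_le | rewrite ell_mobius_transform_gt].
Qed.

Lemma normc_sub1_lt s : 2^-1 < complex.Re (s : R[i]) -> normc (s - 1) < normc s.
Proof.
move=> hs; rewrite -(@ltr_pXn2r _ 2) ?nnegrE ?normc_ge0 // !sqr_normcE.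
by case: s hs => x y /= hs; rewrite oppr0 addr0; nra.
Qed.

End ZetaPowers.

Unset Implicit Arguments.

Theorem theorem1 (R : realType) (k : nat) (hk : (0 < k)%N) (s : C R)
  (hs1 : s != 1) (hs : (2^-1 : R) < complex.Re (s : R[i])) :
  let w : C R := (s - 1) / s in
  let u : nat -> C R := fun m =>
    let n : int := (m%:Z - k%:Z)%R in (-1) ^ n * ell R n k * w ^ n in
  cvgn (series (fun m => `|u m|)) /\ zeta s ^+ k = limn (series u).
Proof.
move=> w u; have lt_s := normc_sub1_lt hs.
have s0 : s != 0 by apply: contraTneq lt_s => ->; rewrite normc0 -leNgt normc_ge0.
have w0 : w != 0 by rewrite mulf_neq0 ?invr_eq0 ?subr_eq0.
have w1 : normc w < 1 by rewrite normcM normcV ltr_pdivrMr ?mul1r ?normc_gt0.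
have w_powser := powserZ (c := w ^- k) (@powser_ell R k).
have uE : u = fun m => w ^- k * ((-1) ^ (m%:Z - k%:Z) * ell R (m%:Z - k%:Z) k) * w ^+ m.
  by apply/funext => m; rewrite /u (expfzDr _ _ w0) -invr_expz -!exprnP; ring.
have zetaE : w ^- k * ((1 - w) ^+ k * zetak_reg k (1 - w)^-1) = zeta s ^+ k.
  have -> : 1 - w = s^-1 by rewrite /w; field.
  rewrite invrK /zetak_reg (negbTE hs1) exprMn /w exprMn !exprVn; field.
  by rewrite !expf_neq0 ?subr_eq0.
split; first by rewrite uE; exact: powser_normr_cvg w_powser w1.
have := powser_cvg w_powser w1; rewrite -uE zetaE.
by move/cvg_lim => -> //; exact: norm_hausdorff.
Qed.
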